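(* Let $\mathcal{L}\subseteq\mathbf{Z}^n$ be a lattice of dimension $m$ and $B\in\mathbf{Z}^{n\times m}$ a matrix whose columns form a basis of $\mathcal{L}$. Then $V_{\mathcal{L}}$ has the irreducible primary decomposition $$V_{\mathcal{L}}=\bigcap_{Q^{\bar\tau}_u}\langle x_i^{u_i+1} : i\in\bar\tau\rangle,$$ where the intersection is taken over all critical $Q^{\bar\tau}_u$ (with $u\in\mathbf{N}^n$, $\tau\subseteq[n]$).
   Context: $S=k[x_1,\ldots,x_n]$, $x^u=\prod_i x_i^{u_i}$, $[n]=\{1,\ldots,n\}$, $e_i$ the $i$-th unit vector. For $u\in\mathbf{N}^n$ the fiber is $P_u=\mathrm{conv}\{v\in\mathbf{N}^n: u-v\in\mathcal{L}\}$; the vertex ideal $V_{\mathcal{L}}$ is the monomial ideal spanned by monomials $x^v$ with $v$ not a vertex of $P_v$. For $\tau\subseteq[n]$ write $\bar\tau=[n]\setminus\tau$. For $u\in\mathbf{N}^n$, $Q^{\bar\tau}_u=\{x\in\mathbf{R}^m: B^{\bar\tau}x\le u^{\bar\tau}\}$ (only the rows/coordinates indexed by $\bar\tau$ are kept), and $R^{\bar\tau}_u$ is the convex hull of $Q^{\bar\tau}_u\cap\mathbf{Z}^m$. $Q^{\bar\tau}_u$ is called critical if the origin is a vertex of $R^{\bar\tau}_u$ but is not a vertex of $R^{\bar\tau}_{u+e_i}$ for any $i\in\bar\tau$. *)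

(* Defs.v *)
From HB Require Import structures.
From mathcomp Require Import all_boot all_order all_algebra.
From mathcomp Require Import ring_quotient.
From mathcomp Require Import boolp classical_sets cardinality reals.
From mathcomp Require Import mpoly.

Set Implicit Arguments.
Unset Strict Implicit.
Unset Printing Implicit Defensive.

Import Order.TTheory GRing.Theory Num.Theory.

Local Open Scope classical_set_scope.
Local Open Scope ring_scope.

Section Convexity.
Variables (R : realType) (E : lmodType R).

Definition convex_hull (A : set E) : set E :=
  [set x | exists (r : nat) (a : 'I_r -> R) (y : 'I_r -> E),
     [/\ forall i, 0 <= a i, \sum_i a i = 1, forall i, A (y i)
       & x = \sum_i a i *: y i]].

(* A vertex of a convex set is an extreme point: v belongs to P and is not in
   the relative interior of a nondegenerate segment contained in P. *)
Definition is_vertex (P : set E) (v : E) : Prop :=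
  P v /\ forall (x y : E) (t : R), P x -> P y -> 0 < t < 1 ->
    v = (1 - t) *: x + t *: y -> x = v /\ y = v.

End Convexity.

Section Lattice.
Variables n m : nat.

Definition int_vec (v : 'X_{1..n}) : 'cV[int]_n := \col_i (v i)%:Z.

(* The columns of B span L over the integers and are linearly independent, so
   that L has rank m. *)
Definition lattice_basis (L : {pred 'cV[int]_n}) (B : 'M[int]_(n, m)) : Prop :=
  (forall v, v \in L <-> exists z : 'cV[int]_m, v = B *m z) /\
  (forall z : 'cV[int]_m, B *m z = 0 -> z = 0).

Variable R : realType.

Definition real_vec p (v : 'cV[int]_p) : 'cV[R]_p := map_mx intr v.

Definition fiber (L : {pred 'cV[int]_n}) (u : 'X_{1..n}) : set 'cV[R]_n :=
  convex_hull [set real_vec (int_vec v) |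
                v in [set v : 'X_{1..n} | int_vec u - int_vec v \in L]].

Variable B : 'M[int]_(n, m).

Definition Qpoly (tau : {set 'I_n}) (u : 'X_{1..n}) : set 'cV[R]_m :=
  [set x | forall i, i \in (~: tau)%SET ->
     (map_mx intr B *m x) i 0 <= (u i)%:R].

Definition Rhull (tau : {set 'I_n}) (u : 'X_{1..n}) : set 'cV[R]_m :=
  convex_hull (Qpoly tau u `&` range (@real_vec m)).

Definition critical (tau : {set 'I_n}) (u : 'X_{1..n}) : Prop :=
  is_vertex (Rhull tau u) 0 /\
  forall i, i \in (~: tau)%SET -> ~ is_vertex (Rhull tau (u + U_(i))%MM) 0.

End Lattice.

Arguments fiber {n} R L u.
Arguments critical {n m} R B tau u.

Section Ideals.
Variable A : comNzRingType.

Definition ideal_gen (G : set A) : set A :=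
  [set p | exists (r : nat) (a g : 'I_r -> A),
     (forall i, G (g i)) /\ p = \sum_i a i * g i].

Definition primary_ideal (I : set A) : Prop :=
  idealr_closed (mem I) /\
  forall f g, I (f * g) -> I f \/ exists e : nat, I (g ^+ e).

(* idealr_closed means "proper ideal"; allowing J or K to be the unit ideal
   would not change the notion, since J = A forces I = K. *)
Definition irreducible_ideal (I : set A) : Prop :=
  idealr_closed (mem I) /\
  forall J K : set A, idealr_closed (mem J) -> idealr_closed (mem K) ->
    I = J `&` K -> I = J \/ I = K.

(* A finite irredundant intersection of ideals that are both irreducible and
   primary; C is the set of components. *)
Definition irreducible_primary_decomposition (V : set A) (C : set (set A)) :
    Prop :=
  [/\ finite_set C,
      forall I, C I -> irreducible_ideal I /\ primary_ideal I,
      V = \bigcap_(I in C) I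
    & forall I, C I -> V <> \bigcap_(J in C `\ I) J].

End Ideals.

Section VertexIdeal.
Variables (k : fieldType) (R : realType) (n : nat).

(* The k-linear span of the monomials x^v with v not a vertex of its fiber. *)
Definition vertex_ideal (L : {pred 'cV[int]_n}) : set {mpoly k[n]} :=
  [set p | exists (r : nat) (c : 'I_r -> k) (v : 'I_r -> 'X_{1..n}),
     (forall i, ~ is_vertex (fiber R L (v i)) (real_vec R (int_vec (v i)))) /\
     p = \sum_i c i *: 'X_[v i]].

Definition powers_ideal (tau : {set 'I_n}) (u : 'X_{1..n}) :
    set {mpoly k[n]} :=
  ideal_gen [set 'X_[U_(i)] ^+ (u i).+1 | i in [set i | i \in (~: tau)%SET]].

End VertexIdeal.

Arguments vertex_ideal k R {n} L.
Arguments powers_ideal k {n} tau u.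

(* Main.v *)
(* By is_vertex_hullP, whether the origin is a vertex of R^{bar tau}_u is a
   condition on finite convex combinations of lattice points, antitone in
   (tau, u) for the order of (N + {oo})^n that puts oo at the indices in tau.
   Since such a combination satisfies a constraint as soon as its bound is large
   enough, the set of good exponents is closed under passing to oo in a
   coordinate, so every good exponent lies below a maximal one, and the maximal
   ones are the critical pairs.  The monomial x^v lies outside V_L iff (set0, v)
   is good, iff v lies below a critical pair, iff x^v lies outside one of the
   components.  Critical pairs form an antichain, hence are finitely many by
   Dickson's lemma, and their maximality gives irredundancy.  Modulo
   <x_i^{u_i+1} : i notin tau> every nonzero element has a monomial multiple in
   the socle x^u k[x_tau], which is torsion-free over k[x_tau]; irreducibility
   and primariness follow. *)
Require Import Defs.
From HB Require Import structures.
From mathcomp Require Import all_boot all_order all_algebra.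
From mathcomp Require Import ring_quotient.
From mathcomp Require Import boolp classical_sets functions cardinality reals.
From mathcomp Require Import mpoly.

Set Implicit Arguments.
Unset Strict Implicit.
Unset Printing Implicit Defensive.

Import Order.TTheory GRing.Theory Num.Theory.

Local Open Scope classical_set_scope.
Local Open Scope ring_scope.

(** * Extreme points of convex hulls *)

Section Vertices.
Variables (R : realType) (E : lmodType R).

Lemma sub_convex_hull (A : set E) v : A v -> convex_hull A v.
Proof.
move=> Av; exists 1%N, (fun _ => 1), (fun _ => v); split=> //.
  by rewrite big_ord1.
by rewrite big_ord1 scale1r.
Qed.

(** A point of weight strictly between 0 and 1 and the renormalised rest bound a segment through
    [v]. Conversely, combinations for the two ends of a segment concatenate, with weights scaled by
    [1 - t] and [t]. *)
Lemma is_vertex_hullP (A : set E) v : A v ->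
  is_vertex (convex_hull A) v <->
  forall (r : nat) (a : 'I_r -> R) (y : 'I_r -> E),
    (forall i, 0 <= a i) -> \sum_i a i = 1 -> (forall i, A (y i)) ->
    v = \sum_i a i *: y i -> forall i, 0 < a i -> y i = v.
Proof.
move=> Av; split=> [[_ vE] r a y a0 a1 Ay vy i ai0 | H].
  have sD : \sum_(j | j != i) a j = 1 - a i.
    by rewrite -a1 [in RHS](bigD1 i) //= addrAC subrr add0r.
  have ai1 : a i <= 1 by rewrite -subr_ge0 -sD sumr_ge0.
  move: (ai1); rewrite le_eqVlt => /orP[/eqP ai|ai].
    have aj j : j != i -> a j = 0.
      move/eqP: sD; rewrite ai subrr psumr_eq0 // => /allP/(_ j).
      by rewrite mem_index_enum => /(_ isT)/implyP aj /aj/eqP.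
    rewrite vy (bigD1 i) //= ai scale1r big1 ?addr0 // => j /aj ->.
    by rewrite scale0r.
  have ti : 0 < 1 - a i by rewrite subr_gt0.
  pose x := \sum_j (if j == i then 0 else (1 - a i)^-1 * a j) *: y j.
  have sE : \sum_j (if j == i then 0 else (1 - a i)^-1 * a j) = 1.
    rewrite (bigD1 i) //= eqxx add0r.
    under eq_bigr => j /negbTE -> do [].
    by rewrite -mulr_sumr sD mulVf // gt_eqF.
  have Hx : convex_hull A x.
    exists r, (fun j => if j == i then 0 else (1 - a i)^-1 * a j), y.
    split=> // j; case: ifP => // _.
    by rewrite mulr_ge0 // invr_ge0 ltW.
  have [] // := vE x (y i) (a i) Hx (sub_convex_hull (Ay i)).
    by rewrite ai0.
  rewrite vy /x [in LHS](bigD1 i) //= addrC; congr (_ + _).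
  rewrite [in RHS](bigD1 i) //= eqxx scale0r add0r scaler_sumr.
  apply: eq_bigr => j /negbTE ->.
  by rewrite scalerA mulrA mulfV ?mul1r // gt_eqF.
split; first exact: sub_convex_hull.
move=> x y t [r [a [p [a0 a1 Ap xE]]]] [s [b [q [b0 b1 Aq yE]]]] /andP[t0 t1] vE.
pose c (k : 'I_(r + s)) :=
  match fintype.split k with inl i => (1 - t) * a i | inr j => t * b j end.
pose z (k : 'I_(r + s)) := match fintype.split k with inl i => p i | inr j => q j end.
have cl i : c (lshift s i) = (1 - t) * a i by rewrite /c (unsplitK (inl i)).
have cr i : c (rshift r i) = t * b i by rewrite /c (unsplitK (inr i)).
have zl i : z (lshift s i) = p i by rewrite /z (unsplitK (inl i)).
have zr i : z (rshift r i) = q i by rewrite /z (unsplitK (inr i)).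
have u0 : 0 < 1 - t by rewrite subr_gt0.
have zv : forall k, 0 < c k -> z k = v.
  apply: H.
  - by move=> k; rewrite /c; case: (fintype.split k) => j; rewrite mulr_ge0 // ltW.
  - rewrite big_split_ord /=.
    under eq_bigr do rewrite cl; under [X in _ + X]eq_bigr do rewrite cr.
    by rewrite -!mulr_sumr a1 b1 !mulr1 subrK.
  - by move=> k; rewrite /z; case: (fintype.split k).
  - rewrite vE xE yE big_split_ord /= !scaler_sumr.
    by congr (_ + _); apply: eq_bigr => i _; rewrite ?cl ?cr ?zl ?zr scalerA.
split.
  rewrite xE -[RHS]scale1r -a1 scaler_suml; apply: eq_bigr => i _.
  have := a0 i; rewrite le_eqVlt => /orP[/eqP <-|ai]; first by rewrite !scale0r.
  by rewrite -[p i]zl zv // cl mulr_gt0.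
rewrite yE -[RHS]scale1r -b1 scaler_suml; apply: eq_bigr => i _.
have := b0 i; rewrite le_eqVlt => /orP[/eqP <-|ai]; first by rewrite !scale0r.
by rewrite -[q i]zr zv // cr mulr_gt0.
Qed.

End Vertices.

(** Clearing denominators carries independence of the columns from the integers to the rationals;
    extending the field to [R] preserves it. *)
Lemma lattice_basis_real_inj (R : realType) (n m : nat)
    (L : {pred 'cV[int]_n}) (B : 'M[int]_(n, m)) : lattice_basis L B ->
  forall x : 'cV[R]_m, map_mx intr B *m x = 0 -> x = 0.
Proof.
move=> [_ Binj].
have Bfree : row_free (map_mx intr B^T : 'M[rat]_(m, n)).
  apply: inj_row_free => v vB.
  pose d := \prod_i denq (v 0 i).
  have d0 : d != 0 by apply/prodf_neq0 => i _; rewrite denq_neq0.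
  pose z : 'cV[int]_m := \col_i (numq (v 0 i) * \prod_(j | j != i) denq (v 0 j)).
  have zE i : (z i 0)%:~R = v 0 i * d%:~R :> rat.
    have e : v 0 i * (denq (v 0 i))%:~R = (numq (v 0 i))%:~R.
      by rewrite -{1}[v 0 i]divq_num_den mulfVK // intr_eq0 denq_neq0.
    by rewrite mxE /d [in RHS](bigD1 i) //= !rmorphM mulrA e.
  have z0 : z = 0.
    apply: Binj; apply/matrixP => i j; rewrite ord1 !mxE.
    apply: (@intr_inj rat); rewrite rmorph_sum /=.
    transitivity (d%:~R * (v *m map_mx intr B^T) 0 i : rat); last first.
      by rewrite vB !mxE mulr0.
    rewrite [(v *m _) 0 i]mxE mulr_sumr; apply: eq_bigr => l _.
    by rewrite intrM zE !mxE mulrC -mulrA mulrCA.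
  apply/rowP => i; rewrite mxE; apply/eqP.
  have /eqP := zE i; rewrite z0 mxE /= eq_sym mulf_eq0 => /orP[//|].
  by rewrite intr_eq0 (negbTE d0).
move=> x Bx; apply: trmx_inj; rewrite trmx0.
have : row_free (map_mx ratr (map_mx intr B^T) : 'M[R]_(m, n)).
  by rewrite row_free_map.
rewrite -map_mx_comp => /row_free_inj; apply.
rewrite mul0mx.
have -> : map_mx (ratr \o intr) B^T = (map_mx intr B)^T :> 'M[R]_(m, n).
  by apply/matrixP => i j; rewrite !mxE /= ratr_int.
by rewrite -trmx_mul Bx trmx0.
Qed.

(** * Exponents with infinite entries and Dickson's lemma *)

Section ExponentOrder.
Variable n : nat.
Implicit Types P Q S : {set 'I_n} * 'X_{1..n}.

(* A pair (tau, u) encodes the vector in (N + {oo})^n with entry oo at the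
   indices in tau and u_j at the others; exp_le is the product order. *)
Definition exp_le P Q : bool :=
  [forall j, (j \notin Q.1) ==> (j \notin P.1) && (P.2 j <= Q.2 j)%N].

Lemma exp_leP P Q :
  reflect (forall j, j \notin Q.1 -> j \notin P.1 /\ (P.2 j <= Q.2 j)%N)
          (exp_le P Q).
Proof.
apply: (iffP forallP) => H j; first by move/implyP: (H j) => /[apply] /andP.
by apply/implyP => /H /andP.
Qed.

Lemma exp_le_refl P : exp_le P P.
Proof. by apply/exp_leP. Qed.

Lemma exp_le_trans Q P S : exp_le P Q -> exp_le Q S -> exp_le P S.
Proof.
move=> /exp_leP PQ /exp_leP QS; apply/exp_leP => j /QS[/PQ[-> PQj] QSj].
by split=> //; apply: leq_trans QSj.
Qed.

Let coord_le j P Q : bool :=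
  (j \notin Q.1) ==> (j \notin P.1) && (P.2 j <= Q.2 j)%N.

(** Take a least finite [j]-entry from [N] on; if there is none, [N] itself serves. *)
Let coord_min j (f : nat -> {set 'I_n} * 'X_{1..n}) N :
  exists i, (N <= i)%N /\ forall i', (N <= i')%N -> coord_le j (f i) (f i').
Proof.
have [[i [Ni ji]]|H] := pselect (exists i, (N <= i)%N /\ j \notin (f i).1).
  have ex : exists d, `[< exists i, [/\ (N <= i)%N, j \notin (f i).1
                                      & (f i).2 j = d] >].
    by exists ((f i).2 j); apply/asboolP; exists i.
  case: (ex_minnP ex) => d /asboolP[l [Nl jl <-]] dmin.
  exists l; split=> // i' Ni'; apply/implyP => ji'; rewrite jl /=.
  by apply: dmin; apply/asboolP; exists i'.
exists N; split=> // i' Ni'; apply/implyP => ji'.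
by case: H; exists i'.
Qed.

Let coord_subseq j (f : nat -> {set 'I_n} * 'X_{1..n}) :
  exists g : nat -> nat, {homo g : x y / (x < y)%N} /\
    forall x y, (x < y)%N -> coord_le j (f (g x)) (f (g y)).
Proof.
have [h hP] := choice (coord_min j f).
(* Each index minimises the [j]-entry over the tail after its predecessor, so the chosen entries
   never decrease. *)
pose g := fix g x := if x is x'.+1 then h (g x').+1 else h 0%N.
have gS x : (g x < g x.+1)%N by rewrite /=; case: (hP (g x).+1).
have glt : {homo g : x y / (x < y)%N} := homo_ltn ltn_trans gS.
exists g; split=> // x y /glt gxy.
case: x gxy => [|x] /= gxy; first by case: (hP 0%N) => _; apply.
case: (hP (g x).+1) => _; apply.
by apply: leq_trans gxy; apply: ltnW; rewrite ltnS; case: (hP (g x).+1).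
Qed.

(* Dickson's lemma for (N + {oo})^n. *)
Lemma exp_le_wqo (f : nat -> {set 'I_n} * 'X_{1..n}) :
  exists x y, (x < y)%N /\ exp_le (f x) (f y).
Proof.
(* Each new coordinate thins a subsequence already monotone in the earlier ones. *)
suff H (s : seq 'I_n) : exists g : nat -> nat, {homo g : x y / (x < y)%N} /\
    forall x y j, (x < y)%N -> j \in s -> coord_le j (f (g x)) (f (g y)).
  have [g [glt gle]] := H (enum 'I_n).
  exists (g 0%N), (g 1%N); split; first exact: glt.
  by apply/forallP => j; apply: (gle 0%N 1%N j); rewrite ?mem_enum.
elim: s => [|j s [g [glt gle]]]; first by exists id; split.
have [h [hlt hle]] := coord_subseq j (f \o g).
exists (g \o h); split=> [x y xy|x y l xy]; first by apply/glt/hlt.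
rewrite inE => /orP[/eqP ->|ls]; first exact: hle.
by apply: gle => //; apply: hlt.
Qed.

End ExponentOrder.

(** * Critical pairs as maximal exponents keeping the origin extreme *)

Section Critical.
Variables (R : realType) (n m : nat) (B : 'M[int]_(n, m)).
Implicit Types P Q : {set 'I_n} * 'X_{1..n}.

(** The criterion of [is_vertex_hullP] at the origin, put on integer vectors so that [fiber] and
    [Rhull] reduce to one condition. *)
Definition origin_extreme Q : Prop :=
  forall (r : nat) (a : 'I_r -> R) (z : 'I_r -> 'cV[int]_m),
    (forall i, 0 <= a i) -> \sum_i a i = 1 ->
    (forall i j, j \notin Q.1 -> (B *m z i) j 0 <= (Q.2 j)%:Z) ->
    \sum_i a i *: real_vec R (z i) = 0 -> forall i, 0 < a i -> z i = 0.

Lemma real_vec_inj p : injective (@real_vec R p).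
Proof.
move=> v w vw; apply/matrixP => i j; have /matrixP/(_ i j) := vw.
by rewrite !mxE => /eqP; rewrite eqr_int => /eqP.
Qed.

Lemma real_vec0 p : @real_vec R p 0 = 0.
Proof. exact: map_mx0. Qed.

Lemma real_vec_mul (z : 'cV[int]_m) :
  real_vec R (B *m z) = map_mx intr B *m real_vec R z.
Proof. exact: map_mxM. Qed.

Lemma Qpoly_real_vec Q (z : 'cV[int]_m) :
  Qpoly B Q.1 Q.2 (real_vec R z) <->
  forall j, j \notin Q.1 -> (B *m z) j 0 <= (Q.2 j)%:Z.
Proof.
split=> H j.
  move=> jQ; have := H j; rewrite inE jQ -real_vec_mul mxE => /(_ isT).
  by rewrite pmulrn ler_int.
rewrite inE -real_vec_mul => /H; rewrite [real_vec _ _ _ _]mxE pmulrn.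
by rewrite ler_int.
Qed.

Lemma vertex_RhullP Q :
  is_vertex (Rhull B Q.1 Q.2) (0 : 'cV[R]_m) <-> origin_extreme Q.
Proof.
have A0 : (Qpoly B Q.1 Q.2 `&` range (@real_vec R m)) 0.
  split; last by exists 0 => //; rewrite real_vec0.
  rewrite -(real_vec0 m); apply/Qpoly_real_vec => j _.
  by rewrite mulmx0 mxE.
split=> [/(is_vertex_hullP A0) H r a z a0 a1 zQ z0 i ai|H].
  apply: real_vec_inj; rewrite real_vec0.
  apply: (H r a (fun i => real_vec R (z i))) => // {ai}i.
  by split; [apply/Qpoly_real_vec/zQ | exists (z i)].
apply/(is_vertex_hullP A0) => r a y a0 a1 Ay y0 i ai.
have /choice[z zP] : forall i, exists z, real_vec R z = y i.
  by move=> l; have [_ [z _ zy]] := Ay l; exists z.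
rewrite -zP (H r a z) ?real_vec0 //.
  by move=> l j; have [+ _] := Ay l; rewrite -zP => /Qpoly_real_vec; apply.
by under eq_bigr do rewrite zP.
Qed.

Lemma origin_extreme_le P Q :
  exp_le P Q -> origin_extreme Q -> origin_extreme P.
Proof.
move=> /exp_leP PQ HQ r a z a0 a1 zP; apply: HQ => // i j /PQ[jP jPQ].
by apply: le_trans (zP i j jP) _; rewrite lez_nat.
Qed.

(* A convex combination involves only finitely many points, so a constraint
   that can be relaxed arbitrarily far may be dropped. *)
Lemma origin_extreme_drop P i :
  (forall k, origin_extreme (P.1, P.2 + U_(i) *+ k)%MM) ->
  origin_extreme (i |: P.1, P.2)%SET.
Proof.
move=> H r a z a0 a1 zP.
pose k := (\sum_l `|((B *m z l) i 0)%R|)%N.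
apply: (H k) => // l j /= jP; rewrite mnmDE mulmnE mnm1E.
have [<-|ij] := eqVneq i j; last first.
  rewrite mul0n addn0; apply: zP.
  by rewrite !inE negb_or eq_sym ij.
rewrite mul1n PoszD; apply: (le_trans (lez_abs _)).
apply: ler_wpDl => //; rewrite lez_nat.
by rewrite /k (bigD1 l) //= leq_addr.
Qed.

Lemma criticalP Q : critical R B Q.1 Q.2 <-> origin_extreme Q /\
  forall i, i \notin Q.1 -> ~ origin_extreme (Q.1, Q.2 + U_(i))%MM.
Proof.
rewrite /critical; split=> -[/vertex_RhullP H1 H2]; split=> // i iQ.
  by move/vertex_RhullP; apply: H2; rewrite inE.
move/(vertex_RhullP (Q.1, Q.2 + U_(i))%MM); apply: H2.
by move: iQ; rewrite inE.
Qed.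

(** Were [Q] not below [P] at [j], raising [P] by one at [j] would stay below [Q] and keep the
    origin extreme, against criticality. *)
Lemma critical_max P Q : critical R B P.1 P.2 -> origin_extreme Q ->
  exp_le P Q -> exp_le Q P.
Proof.
move=> /criticalP[_ Pmax] HQ PQ; apply/negPn/negP => /forallPn[j].
rewrite negb_imply => /andP[jP H]; apply: (Pmax j jP).
apply: origin_extreme_le HQ; apply/exp_leP => l lQ /=.
have [lP Pl] := exp_leP _ _ PQ l lQ.
split=> //; rewrite mnmDE mnm1E.
have [jl|] := eqVneq j l; last by rewrite addn0.
by move: H; rewrite jl lQ /= addn1 ltnNge.
Qed.

(** Induction on the number of finite entries: one that can grow forever is sent to infinity;
    otherwise all are bounded, and an extension of largest total degree is critical. *)
Lemma exists_critical P : origin_extreme P ->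
  exists Q, critical R B Q.1 Q.2 /\ exp_le P Q.
Proof.
have [N] := ubnP #|(~: P.1)%SET|; elim: N P => // N IHN P cP HP.
have [[i [iP Hi]]|H] := pselect (exists i, i \notin P.1 /\
    forall k, origin_extreme (P.1, P.2 + U_(i) *+ k)%MM).
  have [|Q [Qc PQ]] := IHN (i |: P.1, P.2)%SET _ (origin_extreme_drop Hi).
    rewrite ltnS in cP; apply: leq_trans cP => /=.
    apply/proper_card/fintype.properP; split.
      by apply/fintype.subsetP => j; rewrite !inE negb_or => /andP[].
    by exists i; rewrite !inE ?eqxx.
  exists Q; split=> //; apply: exp_le_trans PQ; apply/exp_leP => j /=.
  by rewrite !inE negb_or => /andP[_ ->].
(* [k i] is an increment of entry [i] alone that fails; by antitonicity it bounds that entry in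
   every good [u] above [P]. *)
have /choice[k kP] : forall i, exists k, i \notin P.1 ->
    ~ origin_extreme (P.1, P.2 + U_(i) *+ k)%MM.
  move=> i; apply: contrapT => /forallNP Hi; apply: H; exists i; split.
    by apply: contrapT => iP; apply: (Hi 0%N).
  by move=> k; apply: contrapT => Hk; apply: (Hi k).
pose deg (u : 'X_{1..n}) := (\sum_(i | i \notin P.1) u i)%N.
pose D d := `[< exists u, [/\ exp_le P (P.1, u), origin_extreme (P.1, u)
                            & deg u = d] >].
have exD : exists d, D d.
  exists (deg P.2); apply/asboolP; exists P.2; split=> //.
  exact: (exp_le_refl P).
have Dub d : D d -> (d <= \sum_(i | i \notin P.1) (P.2 i + k i))%N.
  move=> /asboolP[u [/exp_leP Pu Hu <-]]; apply: leq_sum => i iP.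
  rewrite leqNgt; apply/negP => ui; apply: (kP i iP).
  apply: origin_extreme_le Hu; apply/exp_leP => j /= jP; split=> //.
  rewrite mnmDE mulmnE mnm1E; have [<-|_] := eqVneq i j.
    by rewrite mul1n ltnW.
  by rewrite mul0n addn0; case: (Pu j jP).
case: (ex_maxnP exD Dub) => d /asboolP[u [Pu Hu <-]] dmax.
exists (P.1, u); split=> //; apply/criticalP; split=> //= i iP Hi.
suff : (deg (u + U_(i))%MM <= deg u)%N.
  rewrite /deg (bigD1 i) //= [X in (_ <= X)%N](bigD1 i) //= mnmDE mnm1E eqxx.
  rewrite leqNgt -addnA ltn_add2l add1n ltnS leq_sum // => j _.
  by rewrite mnmDE leq_addr.
apply: dmax; apply/asboolP; exists (u + U_(i))%MM; split=> //.
apply: exp_le_trans Pu _; apply/exp_leP => j /= jP; split=> //.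
by rewrite mnmDE leq_addr.
Qed.

(** The substitution [w = v - B z] is compatible with convex combinations and turns [w >= 0] into
    the constraint [B z <= v]. *)
Lemma vertex_fiberP (L : {pred 'cV[int]_n}) (v : 'X_{1..n}) :
  lattice_basis L B ->
  is_vertex (fiber R L v) (real_vec R (int_vec v)) <->
  origin_extreme (finset.set0, v).
Proof.
move=> HB; have [LB _] := HB.
have A0 : [set real_vec R (int_vec w) |
            w in [set w | int_vec v - int_vec w \in L]] (real_vec R (int_vec v)).
  by exists v => //=; apply/LB; exists 0; rewrite subrr mulmx0.
have comb r (a : 'I_r -> R) (z : 'I_r -> 'cV[int]_m) (w : 'I_r -> 'X_{1..n}) :
  \sum_i a i = 1 -> (forall i, int_vec v - int_vec (w i) = B *m z i) ->
  \sum_i a i *: real_vec R (int_vec (w i)) =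
  real_vec R (int_vec v) - map_mx intr B *m (\sum_i a i *: real_vec R (z i)).
  move=> a1 wz.
  have -> : real_vec R (int_vec v) = \sum_i a i *: real_vec R (int_vec v).
    by rewrite -scaler_suml a1 scale1r.
  rewrite mulmx_sumr -sumrB; apply: eq_bigr => i _.
  rewrite -scalemxAr -scalerBr -real_vec_mul -wz; congr (_ *: _).
  by rewrite -map_mxB opprB addrC subrK.
have wE (w : 'X_{1..n}) z : int_vec v - int_vec w = B *m z ->
    forall j, (B *m z) j 0 = (v j)%:Z - (w j)%:Z.
  by move=> <- j; rewrite !mxE.
split=> [/(is_vertex_hullP A0) H r a z a0 a1 zv z0 i ai|H].
  pose w l := [multinom `|((v j)%:Z - (B *m z l) j 0)%R|%N | j < n]%MM.
  have wz l : int_vec v - int_vec (w l) = B *m z l.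
    apply/matrixP => j o; rewrite ord1 !mxE mnmE.
    rewrite gez0_abs ?subr_ge0; last by apply: zv; rewrite inE.
    by rewrite opprB addrC mxE subrK.
  have /real_vec_inj wv : real_vec R (int_vec (w i)) = real_vec R (int_vec v).
    apply: (H r a (fun l => real_vec R (int_vec (w l)))) => //.
      by move=> l; exists (w l) => //=; apply/LB; exists (z l).
    by rewrite (comb _ _ z) // z0 mulmx0 subr0.
  by apply: (proj2 HB); rewrite -wz wv subrr.
apply/(is_vertex_hullP A0) => r a y a0 a1 Ay yv i ai.
have /choice[w wP] : forall l, exists w, real_vec R (int_vec w) = y l /\
    exists z, int_vec v - int_vec w = B *m z.
  by move=> l; have [w /LB wL wy] := Ay l; exists w.
have /choice[z zP] l := proj2 (wP l).
rewrite -(proj1 (wP i)); congr (real_vec R _).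
suff z0 : z i = 0.
  by apply/esym/eqP; rewrite -subr_eq0 zP z0 mulmx0.
apply: (H r a z) => //.
  by move=> l j _; rewrite (wE (w l)) //= gerBl.
(* The fiber only shows that [B] kills the real combination of the [z l]. *)
apply: (lattice_basis_real_inj HB).
have vw : real_vec R (int_vec v) = \sum_l a l *: real_vec R (int_vec (w l)).
  by rewrite {1}yv; apply: eq_bigr => l _; rewrite (proj1 (wP l)).
rewrite -[LHS](subKr (real_vec R (int_vec v))) -(comb r a z w) //.
by rewrite -vw subrr.
Qed.

End Critical.

(** * Closure rules for ideals given as sets *)

Section IdealClosure.
Variable A : comNzRingType.
Implicit Type I : set A.

Lemma idealr_closedP I : idealr_closed (mem I) <->
  [/\ I 0, ~ I 1 & forall a p q, I p -> I q -> I (a * p + q)].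
Proof.
split=> [[I0 I1 IDM]|[I0 I1 IDM]]; split.
- exact: set_mem I0.
- by move=> /mem_set; apply/negP.
- by move=> a p q /mem_set Ip /mem_set Iq; apply/set_mem/IDM.
- exact: mem_set.
- by apply/negP => /set_mem.
- by move=> a p q /set_mem Ip /set_mem Iq; apply/mem_set/IDM.
Qed.

Variables (I : set A) (idI : idealr_closed (mem I)).

Let closed := (idealr_closedP I).1 idI.

Lemma ideal0 : I 0. Proof. by case: closed. Qed.

Lemma idealD p q : I p -> I q -> I (p + q).
Proof. by case: closed => _ _ H Ip Iq; rewrite -[p]mul1r; apply: H. Qed.

Lemma idealMl a p : I p -> I (a * p).
Proof. by case: closed => I0 _ H Ip; rewrite -[_ * _]addr0; apply: H. Qed.

Lemma idealMr a p : I p -> I (p * a).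
Proof. by rewrite mulrC; apply: idealMl. Qed.

Lemma idealB p q : I p -> I q -> I (p - q).
Proof. by move=> Ip Iq; apply: idealD => //; rewrite -mulN1r; apply: idealMl. Qed.

Lemma ideal_sum T (r : seq T) (P : pred T) (F : T -> A) :
  (forall i, P i -> I (F i)) -> I (\sum_(i <- r | P i) F i).
Proof. by move=> H; elim/big_ind: _ => //; [exact: ideal0 | exact: idealD]. Qed.

End IdealClosure.

(** * Ideals generated by pure powers of variables *)

Section PowersIdeal.
Variables (k : fieldType) (n : nat) (Q : {set 'I_n} * 'X_{1..n}).
Implicit Types (m : 'X_{1..n}) (p f g h : {mpoly k[n]}).

Local Notation tau := Q.1.
Local Notation u := Q.2.
Local Notation I := (powers_ideal k tau u).
Local Notation below m := (exp_le (finset.set0, m) Q).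

Lemma belowP m :
  reflect (forall i, i \notin tau -> (m i <= u i)%N) (below m).
Proof.
apply: (iffP (exp_leP _ _)) => H i /H; first by case.
by rewrite inE.
Qed.

(** A term not below [Q] exceeds [u] at some index off [tau] and is a multiple of that generator. *)
Lemma powers_idealP p :
  I p <-> forall m, m \in msupp p -> ~~ below m.
Proof.
split=> [[r [a [g [gG ->]]]] m|H].
  move=> /msupp_sum_le /flattenP[s /mapP[i _ ->]].
  have [j /=] := gG i; rewrite inE => jtau <-.
  rewrite mpolyXn (perm_mem (msuppMX _ _)) => /mapP[m' _ ->].
  apply/belowP => /(_ j jtau).
  by rewrite mnmDE mulmnE mnm1E eqxx mul1n leqNgt ltnS leq_addr.
pose M := tnth (in_tuple (msupp p)).
have /choice[j jP] : forall i, exists j, j \notin tau /\ (u j < M i j)%N.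
  move=> i; have := H _ (mem_tnth i (in_tuple (msupp p))).
  move=> /forallPn[j]; rewrite negb_imply => /andP[jt].
  by rewrite inE -ltnNge => Mj; exists j.
exists (size (msupp p)), (fun i => p@_(M i) *: 'X_[M i - U_(j i) *+ (u (j i)).+1]),
  (fun i => 'X_[U_(j i)] ^+ (u (j i)).+1); split.
  by move=> i; exists (j i) => //=; rewrite inE; case: (jP i).
rewrite {1}[p]mpolyE big_tnth; apply: eq_bigr => i _.
rewrite mpolyXn -scalerAl -mpolyXD submK //.
apply/mnm_lepP => l; rewrite mulmnE mnm1E.
by have [<-|_] := eqVneq (j i) l; rewrite ?mul1n ?mul0n //; case: (jP i).
Qed.

Lemma powers_ideal_closed : idealr_closed (mem I).
Proof.
apply/idealr_closedP; split.
- by apply/powers_idealP => m; rewrite msupp0.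
- move/powers_idealP => /(_ 0%MM); rewrite msupp1 inE eqxx => /(_ isT)/negP.
  by apply; apply/belowP => i _; rewrite mnm0E.
move=> a p q /powers_idealP Ip /powers_idealP Iq; apply/powers_idealP => m.
move=> /msuppD_le; rewrite mem_cat => /orP[|/Iq //].
move=> /msuppM_le /allpairsP[[m1 m2] /= [_ /Ip m2p ->]].
apply: contra m2p => /belowP H; apply/belowP => i /H.
by apply: leq_trans; rewrite mnmDE leq_addl.
Qed.

(** Polynomials supported on these exponents form the subring [k[x_tau]]. *)
Definition free_exp m := [forall i, (i \notin tau) ==> (m i == 0%N)].

Definition socle_exp : 'X_{1..n} :=
  [multinom if i \in tau then 0%N else u i | i < n].

Lemma free_expM h g : {in msupp h, forall m, free_exp m} ->
  {in msupp g, forall m, free_exp m} -> {in msupp (h * g), forall m, free_exp m}.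
Proof.
move=> hf gf m /msuppM_le /allpairsP[[m1 m2] /= [/hf/forallP H1 /gf/forallP H2 ->]].
apply/forallP => i; apply/implyP => it; rewrite mnmDE.
by rewrite (eqP (implyP (H1 i) it)) (eqP (implyP (H2 i) it)).
Qed.

(** Multiplying by [h] leaves the entries off [tau] equal to [u], so the shifted leading term stays
    below [Q]. *)
Lemma socle_notin h : h != 0 -> {in msupp h, forall m, free_exp m} ->
  ~ I (h * 'X_[socle_exp]).
Proof.
move=> h0 hf /powers_idealP /(_ (socle_exp + mlead h)%MM).
rewrite mcoeff_msupp mcoeffMX -mcoeff_msupp mlead_supp // => /(_ isT)/negP.
apply; apply/belowP => i it; rewrite mnmDE mnmE (negbTE it).
by have /forallP/(_ i)/implyP/(_ it)/eqP -> := hf _ (mlead_supp h0); rewrite addn0.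
Qed.

(* Modulo I the polynomial ring is k[x_tau] tensored with an artinian monomial
   algebra with socle spanned by x^u; multiplying f by a suitable monomial
   moves one of its terms of least degree in that algebra into the socle. *)
Lemma to_socle f : ~ I f -> exists w h,
  [/\ h != 0, {in msupp h, forall m, free_exp m}
    & I (f * 'X_[w] - h * 'X_[socle_exp])].
Proof.
move=> If.
pose deg m := (\sum_(i | i \notin tau) m i)%N.
have ex : exists d, has (fun m => below m && (deg m == d)) (msupp f).
  have : exists m, m \in msupp f /\ below m.
    apply: contrapT => /forallNP H; apply/If/powers_idealP => m mf.
    by apply/negP => mb; apply: (H m).
  by move=> [m [mf mb]]; exists (deg m); apply/hasP; exists m; rewrite ?mb /=.
case: (ex_minnP ex) => _ /hasP[a af /andP[/belowP ab /eqP <-]] amin.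
(* [a] has least degree off [tau] among the terms of [f] below [Q]; [w] lifts it to [u] off [tau],
   and [h] is the [k[x_tau]]-coefficient of its part off [tau]. *)
pose w : 'X_{1..n} := [multinom if i \in tau then 0%N else (u i - a i)%N | i < n].
pose rest m : 'X_{1..n} := [multinom if i \in tau then m i else 0%N | i < n].
pose sel m := [forall i, (i \notin tau) ==> (m i == a i)].
pose h : {mpoly k[n]} := \sum_(m <- msupp f | sel m) f@_m *: 'X_[rest m].
have Ih : I (f * 'X_[w] - h * 'X_[socle_exp]).
  have -> : f * 'X_[w] - h * 'X_[socle_exp] =
      \sum_(m <- msupp f | (m \in msupp f) && ~~ sel m) f@_m *: 'X_[m + w].
    rewrite {1}[f]mpolyE (bigID sel) /= mulrDl addrAC !mulr_suml -sumrB.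
    rewrite big1 ?add0r => [|m /forallP ms].
      rewrite big_seq_cond; apply: eq_bigr => m _.
      by rewrite -scalerAl -mpolyXD.
    rewrite -!scalerAl -!mpolyXD; apply/eqP; rewrite subr_eq0; apply/eqP.
    congr (_ *: 'X_[_]); apply/mnmP => i; rewrite !mnmDE !mnmE.
    case: ifPn => // it; rewrite (eqP (implyP (ms i) it)).
    by rewrite add0n subnKC ?ab.
  apply: (ideal_sum powers_ideal_closed) => m /andP[mf ms].
  apply/powers_idealP => m' /msuppZ_le; rewrite msuppX inE => /eqP ->.
  apply: contra ms => /belowP mb.
  (* If [m + w] is below [Q], then [m <= a] off [tau], and the least degree of [a] forces equality
     there. *)
  have ma i : i \notin tau -> (m i <= a i)%N.
    move=> it; have := mb i it; rewrite mnmDE mnmE (negbTE it).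
    by rewrite -[X in (_ <= X)%N -> _](subnKC (ab i it)) leq_add2r.
  have am : (deg a <= deg m)%N.
    apply/amin/hasP; exists m => //; rewrite eqxx andbT; apply/belowP => i it.
    exact: leq_trans (ma i it) (ab i it).
  apply/forallP => i; apply/implyP => it; rewrite eqn_leq ma //= leqNgt.
  apply/negP => mai; move: am; apply/negP; rewrite -ltnNge.
  rewrite /deg (bigD1 i) //= [X in (_ < X)%N](bigD1 i) //= -addSn.
  by rewrite leq_add // leq_sum // => l /andP[lt _]; apply: ma.
exists w, h; split=> //.
  apply/eqP => h0; move: Ih; rewrite h0 mul0r subr0 => /powers_idealP.
  move=> /(_ (w + a)%MM); rewrite mcoeff_msupp mcoeffMX -mcoeff_msupp.
  move=> /(_ af)/negP; apply; apply/belowP => i it.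
  by rewrite mnmDE mnmE (negbTE it) subnK ?ab.
move=> m /msupp_sum_le /flattenP[s /mapP[m' _ ->] /msuppZ_le].
rewrite msuppX inE => /eqP ->; apply/forallP => i; apply/implyP => it.
by rewrite mnmE (negbTE it).
Qed.

(** Multiples of some [f] in [J] and [g] in [K], both outside [I], reach the socle modulo [I]. The
    product of their [k[x_tau]]-coefficients times [x^u] then lies in both ideals, hence in [I],
    against [socle_notin]. *)
Lemma powers_ideal_irreducible : irreducible_ideal I.
Proof.
split=> [|J K idJ idK IJK]; first exact: powers_ideal_closed.
have [IJ IK] : I `<=` J /\ I `<=` K by rewrite IJK; split; move=> p [].
have [JI|/existsNP[f /not_implyP[Jf If]]] := pselect (J `<=` I).
  by left; apply/seteqP.
right; apply/seteqP; split=> // g Kg; apply: contrapT => Ig.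
have [v [f' [f'0 f'free fE]]] := to_socle If.
have [w [g' [g'0 g'free gE]]] := to_socle Ig.
have Jf' : J (f' * 'X_[socle_exp]).
  rewrite -[_ * _](subKr (f * 'X_[v])).
  by apply: (idealB idJ); [exact: idealMr | exact: IJ].
have Kg' : K (g' * 'X_[socle_exp]).
  rewrite -[_ * _](subKr (g * 'X_[w])).
  by apply: (idealB idK); [exact: idealMr | exact: IK].
apply: (@socle_notin (f' * g')); [exact: mulf_neq0 | exact: free_expM |].
rewrite IJK; split; last by rewrite -mulrA; apply: idealMl.
by rewrite mulrAC; apply: idealMr.
Qed.

(** Each factor [g] adds at least one to the degree off [tau], which for exponents below [Q] is at
    most that of [u]. *)
Lemma nilpotent_powers_ideal g : {in msupp g, forall m, ~~ free_exp m} ->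
  exists e, I (g ^+ e).
Proof.
move=> gf; pose deg m := (\sum_(i | i \notin tau) m i)%N.
have degX e : {in msupp (g ^+ e), forall m, (e <= deg m)%N}.
  elim: e => // e IHe m; rewrite exprS.
  move=> /msuppM_le /allpairsP[[m1 m2] /= [/gf m1g /IHe m2g ->]].
  have -> : deg (m1 + m2)%MM = (deg m1 + deg m2)%N.
    by rewrite /deg -big_split; apply: eq_bigr => i _; rewrite mnmDE.
  move: m1g => /forallPn[i]; rewrite negb_imply => /andP[it m1i].
  by rewrite -add1n leq_add // /deg (bigD1 i) //= addn_gt0 lt0n m1i.
exists (deg u).+1; apply/powers_idealP => m /degX; apply: contraTN.
by move=> /belowP mu; rewrite -leqNgt; apply: leq_sum.
Qed.

(** Split [g] into [g0] in [k[x_tau]] and [g1], whose terms all involve a variable off [tau]. Since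
    [g1] is nilpotent modulo [I] and kills the socle, a nonzero [g0] would put [h * g0] times the
    socle generator in [I]. *)
Lemma powers_ideal_primary : primary_ideal I.
Proof.
split=> [|f g Ifg]; first exact: powers_ideal_closed.
have [|/to_socle[w [h [h0 hfree fE]]]] := pselect (I f); first by left.
right; pose g0 : {mpoly k[n]} := \sum_(m <- msupp g | free_exp m) g@_m *: 'X_[m].
pose g1 : {mpoly k[n]} := \sum_(m <- msupp g | ~~ free_exp m) g@_m *: 'X_[m].
have gE : g = g0 + g1 by rewrite {1}[g]mpolyE (bigID free_exp).
have g0free : {in msupp g0, forall m, free_exp m}.
  move=> m /msupp_sum_le /flattenP[s /mapP[m']].
  by rewrite mem_filter => /andP[m'f _] -> /msuppZ_le; rewrite msuppX inE => /eqP ->.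
have g1free : {in msupp g1, forall m, ~~ free_exp m}.
  move=> m /msupp_sum_le /flattenP[s /mapP[m']].
  by rewrite mem_filter => /andP[m'f _] -> /msuppZ_le; rewrite msuppX inE => /eqP ->.
have [g00|g0N] := eqVneq g0 0.
  by apply: nilpotent_powers_ideal; rewrite gE g00 add0r.
have idI := powers_ideal_closed.
have Ig1 : I (g1 * 'X_[socle_exp]).
  apply/powers_idealP => m; rewrite (perm_mem (msuppMX _ _)) => /mapP[m1 /g1free].
  move=> /forallPn[i]; rewrite negb_imply => /andP[it m1i] ->.
  apply/belowP => /(_ i it); rewrite mnmDE mnmE (negbTE it).
  by apply/negP; rewrite -ltnNge -addn1 leq_add2l lt0n.
case: (@socle_notin (h * g0)); [exact: mulf_neq0 | exact: free_expM |].
have -> : h * g0 * 'X_[socle_exp] = f * g * 'X_[w]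
    - (f * 'X_[w] - h * 'X_[socle_exp]) * g - h * (g1 * 'X_[socle_exp]).
  rewrite mulrBl opprB addrCA [f * g * _]mulrAC subrr addr0 gE mulrDr.
  by rewrite [h * (_ * _)]mulrA -[h * _ * g1]mulrAC addrK mulrAC.
apply: (idealB idI); last exact: idealMl.
by apply: (idealB idI); apply: (idealMr idI).
Qed.

End PowersIdeal.

(** [exp_le] is only a preorder, as pairs may differ in [u] on [tau]; equivalent pairs have the same
    exponents below them. *)
Lemma eq_powers_ideal (k : fieldType) n (P Q : {set 'I_n} * 'X_{1..n}) :
  exp_le P Q -> exp_le Q P -> powers_ideal k P.1 P.2 = powers_ideal k Q.1 Q.2.
Proof.
move=> PQ QP; apply/seteqP.
by split=> p /powers_idealP H; apply/powers_idealP => m /H; apply: contra => mle;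
  apply: exp_le_trans mle _.
Qed.

(** * Decomposition of the vertex ideal *)

Section Decomposition.
Variables (k : fieldType) (R : realType) (n m : nat).
Variables (L : {pred 'cV[int]_n}) (B : 'M[int]_(n, m)).
Hypothesis HB : lattice_basis L B.

Lemma vertex_idealP (p : {mpoly k[n]}) : vertex_ideal k R L p <->
  forall v, v \in msupp p -> ~ origin_extreme R B (finset.set0, v).
Proof.
split=> [[r [c [v [vN ->]]]] w|H].
  move=> /msupp_sum_le /flattenP[s /mapP[i _ ->] /msuppZ_le].
  by rewrite msuppX inE => /eqP -> /(vertex_fiberP R _ HB); apply: vN.
exists (size (msupp p)), (fun i => p@_(tnth (in_tuple (msupp p)) i)),
  (tnth (in_tuple (msupp p))); split=> [i|].
  by move=> /(vertex_fiberP R _ HB); apply/H/(mem_tnth i (in_tuple _)).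
by rewrite {1}[p]mpolyE big_tnth.
Qed.

Let C := [set powers_ideal k Q.1 Q.2 |
  Q in [set Q : {set 'I_n} * 'X_{1..n} | critical R B Q.1 Q.2]].

Lemma vertex_ideal_bigcap : vertex_ideal k R L = \bigcap_(I in C) I.
Proof.
apply/seteqP; split=> p.
  move=> /vertex_idealP H I [Q /= Qc <-]; apply/powers_idealP => v vp.
  apply/negP => vQ; apply: (H v vp); apply: origin_extreme_le vQ _.
  by have [] := (criticalP _ _ _).1 Qc.
move=> H; apply/vertex_idealP => v vp /exists_critical[Q [Qc vQ]].
have /powers_idealP/(_ v vp) : powers_ideal k Q.1 Q.2 p by apply: H; exists Q.
by rewrite vQ.
Qed.

(* Critical pairs form an antichain for exp_le. *)
Lemma finite_components : finite_set C.
Proof.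
apply: contrapT => /infiniteP/pcard_leP[F].
have /choice[Q QP] : forall i, exists Q, critical R B Q.1 Q.2 /\
    powers_ideal k Q.1 Q.2 = F i.
  by move=> i; have [Q ? ?] := @funS _ _ _ _ F i I; exists Q.
have [i [j [ij Qij]]] := exp_le_wqo Q.
have [[Qi Fi] [Qj Fj]] := (QP i, QP j).
have Qji := critical_max Qi ((criticalP _ _ _).1 Qj).1 Qij.
have Fij : F i = F j by rewrite -Fi -Fj; apply: eq_powers_ideal.
by move: ij; rewrite (inj _ _ Fij) ?ltnn // in_setE.
Qed.

(** A component may come from infinitely many pairs, differing in [u] on [tau], so one pair is
    chosen for each of the finitely many components. *)
Lemma components_bounded : exists N, forall I, C I -> exists Q,
  [/\ critical R B Q.1 Q.2, powers_ideal k Q.1 Q.2 = I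
    & forall i, (Q.2 i <= N)%N].
Proof.
have /finite_seqP[s Cs] := finite_components.
have sC : {subset s <= C} by move=> I Is; rewrite Cs in_setE.
rewrite Cs; elim: s sC {Cs} => [|I s IHs] sC.
  by exists 0%N.
have [|N HN] := IHs; first by move=> J Js; apply: sC; rewrite inE Js orbT.
have /set_mem[Q /= Qc QI] : I \in C by apply: sC; rewrite inE eqxx.
exists (maxn N (mdeg Q.2)) => J /=; rewrite inE => /orP[/eqP ->|/HN[Q' [? ? H]]].
  exists Q; split=> // i; rewrite leq_max; apply/orP; right.
  by rewrite mdegE (bigD1 i) //= leq_addr.
by exists Q'; split=> // i; rewrite leq_max H.
Qed.

(* The exponent agreeing with u off tau and exceeding on tau every finite
   entry of a component lies outside the component of (tau, u) only. *)
Lemma components_irredundant I : C I ->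
  vertex_ideal k R L <> \bigcap_(J in C `\ I) J.
Proof.
move=> [Q /= Qc <-] VE; have [N HN] := components_bounded.
have [QE _] := (criticalP _ _ _).1 Qc.
pose v : 'X_{1..n} := [multinom if i \in Q.1 then N.+1 else Q.2 i | i < n].
have vQ : exp_le (finset.set0, v) Q.
  by apply/belowP => i it; rewrite mnmE (negbTE it).
have : ~ vertex_ideal k R L 'X_[v].
  move=> /vertex_idealP/(_ v); rewrite msuppX inE eqxx => /(_ isT); apply.
  exact: origin_extreme_le vQ QE.
apply; rewrite VE => J [/HN[S [Sc <- SN]] JQ].
apply/powers_idealP => w; rewrite msuppX inE => /eqP ->.
apply/negP => /belowP vS; apply: JQ.
(* Where [S] is finite, [v] is at most [N], so the value [N.+1] excludes the indices in [Q.1]. *)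
have QS : exp_le Q S.
  apply/exp_leP => i iS; have := vS i iS; rewrite mnmE.
  by case: ifP => // _ /leq_trans/(_ (SN i)); rewrite ltnn.
apply: eq_powers_ideal => //.
by apply: critical_max Qc _ QS; have [] := (criticalP _ _ _).1 Sc.
Qed.

End Decomposition.

Theorem theorem3p8 (k : fieldType) (R : realType) (n m : nat)
    (L : zmodClosed 'cV[int]_n) (B : 'M[int]_(n, m))
    (HB : lattice_basis L B) :
  irreducible_primary_decomposition (vertex_ideal k R L)
    [set powers_ideal k Q.1 Q.2 |
      Q in [set Q : {set 'I_n} * 'X_{1..n} | critical R B Q.1 Q.2]].
Proof.
split.
- exact: finite_components.
- move=> _ [Q _ <-].
  by split; [exact: powers_ideal_irreducible | exact: powers_ideal_primary].
- exact: vertex_ideal_bigcap HB.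
- exact: components_irredundant HB.
Qed.
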